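(* Let $G$ be a commutative linearly ordered group. Then the following conditions are equivalent: (i) $G$ is archimedean; (ii) every non-trivial congruence on $\mathscr{B}(G)$ is a group congruence; (iii) every non-trivial congruence on $\mathscr{B}^+(G)$ is a group congruence.
   Context: A linearly ordered group is a group $G$ (identity $e$) with a total order $\leqslant$ such that $a\leqslant b$ implies $ag\leqslant bg$ and $ga\leqslant gb$ for all $a,b,g\in G$; $G^+=\{x\in G: e\leqslant x\}$. $G$ is archimedean if for all $a,b\in G^+\setminus\{e\}$ there exist positive integers $m,n$ with $b\leqslant a^m$ and $a\leqslant b^n$. For $g,h\in G$, $\alpha^g_h$ is the partial map $G\rightharpoonup G$ with domain $G^+(g)=\{x\in G: g\leqslant x\}$ given by $(x)\alpha^g_h=x g^{-1}h$. Put $\mathscr{B}(G)=\{\alpha^g_h: g,h\in G\}$ and $\mathscr{B}^+(G)=\{\alpha^g_h: g,h\in G^+\}$; these are semigroups under composition of partial maps (maps written on the right, $x(\alpha\beta)=(x\alpha)\beta$ for $x\in\operatorname{dom}\alpha$ with $x\alpha\in\operatorname{dom}\beta$); explicitly $\alpha^g_h\cdot\alpha^k_l=\alpha^a_b$ with $a=(h\vee k)h^{-1}g$, $b=(h\vee k)k^{-1}l$, where $\vee$ is maximum. A congruence on a semigroup $S$ is non-trivial if it is distinct from both the universal congruence $S\times S$ and the identity congruence; it is a group congruence if the quotient semigroup is a group. *)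

(* Defs.v *)
From HB Require Import structures.
From mathcomp Require Import all_boot all_order boolp.

Set Implicit Arguments.
Unset Strict Implicit.
Unset Printing Implicit Defensive.

Import Order.TTheory.
Local Open Scope group_scope.

HB.mixin Record isLinearlyOrderedGroup d G
    of Order.Total d G & Group G := {
  leM2r : forall g a b : G, (a <= b)%O -> (a * g <= b * g)%O;
  leM2l : forall g a b : G, (a <= b)%O -> (g * a <= g * b)%O
}.

#[short(type="loGroupType")]
HB.structure Definition LOGroup d :=
  {G of isLinearlyOrderedGroup d G & Order.Total d G & Group G}.

Definition archimedean_group (d : Order.disp_t) (G : loGroupType d) : Prop :=
  forall a b : G, (1 < a)%O -> (1 < b)%O ->
  exists m n : nat,
    [/\ (0 < m)%N, (0 < n)%N, (b <= a ^+ m)%O & (a <= b ^+ n)%O].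

(* [None] means "undefined".  Maps are written on the right, so that
   [f * g] applies [f] first. *)
Definition partial_map (T : choiceType) : Type := T -> option T.

Section PartialMaps.
Variable T : choiceType.

HB.instance Definition _ := Choice.on (partial_map T).

Definition partial_map_mul (f g : partial_map T) : partial_map T := pcomp g f.

Lemma partial_map_mulA : associative partial_map_mul.
Proof.
by move=> f g h; apply/funext => x; rewrite /partial_map_mul /pcomp; case: (f x).
Qed.

HB.instance Definition _ := isSemigroup.Build (partial_map T) partial_map_mulA.

End PartialMaps.

Section BicyclicExtensions.
Variables (d : Order.disp_t) (G : loGroupType d).
Implicit Types g h k l x : G.

Definition alpha g h : partial_map G :=
  fun x => if (g <= x)%O then Some (x * g^-1 * h) else None.

Lemma leM2rE g x y : (x * g <= y * g)%O = (x <= y)%O.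
Proof.
by apply/idP/idP => [/(leM2r g^-1)|/leM2r]; rewrite ?mulgK.
Qed.

Lemma alphaM g h k l :
  alpha g h * alpha k l =
    alpha (Order.max h k * h^-1 * g) (Order.max h k * k^-1 * l).
Proof.
apply/funext => x; rewrite -[LHS]/(obind (alpha k l) (alpha g h x)) /alpha.
have -> : (Order.max h k * h^-1 * g <= x)%O =
          (g <= x)%O && (k <= x * g^-1 * h)%O.
  rewrite -[LHS](leM2rE g^-1) mulgK -[LHS](leM2rE h) mulgVK ge_max.
  congr (_ && _).
  by rewrite -[LHS](leM2rE h^-1) mulgK mulgV -[LHS](leM2rE g) mul1g mulgVK.
case: (g <= x)%O => //=; case: ifP => // _.
by rewrite !invgM !invgK !mulgA mulgVK.
Qed.

Definition Bpred : {pred partial_map G} :=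
  fun f => `[< exists g h : G, f = alpha g h >].

Definition Bplus_pred : {pred partial_map G} :=
  fun f => `[< exists g h : G, [/\ (1 <= g)%O, (1 <= h)%O & f = alpha g h] >].

Lemma Bpred_mul : mulg_closed Bpred.
Proof.
move=> _ _ /asboolP[g [h ->]] /asboolP[k [l ->]].
by rewrite alphaM; apply/asboolP; do 2!eexists.
Qed.

Lemma le1M x y : (1 <= x)%O -> (1 <= y)%O -> (1 <= x * y)%O.
Proof. by move=> x1 y1; apply: le_trans y1 _; rewrite -{1}[y]mul1g leM2rE. Qed.

Lemma Bplus_pred_mul : mulg_closed Bplus_pred.
Proof.
move=> _ _ /asboolP[g [h [g1 h1 ->]]] /asboolP[k [l [k1 l1 ->]]].
rewrite alphaM; apply/asboolP; do 2!eexists; split; last by [].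
  by apply: le1M => //; rewrite -(leM2rE h) mul1g mulgVK le_max lexx.
by apply: le1M => //; rewrite -(leM2rE k) mul1g mulgVK le_max lexx orbT.
Qed.

Record B := MkB { B_val :> partial_map G; B_valP : B_val \in Bpred }.
HB.instance Definition _ := [isSub for B_val].
HB.instance Definition _ := [Choice of B by <:].
HB.instance Definition _ :=
  SubChoice_isSubSemigroup.Build (partial_map G) Bpred B Bpred_mul.

Record Bplus :=
  MkBplus { Bplus_val :> partial_map G; Bplus_valP : Bplus_val \in Bplus_pred }.
HB.instance Definition _ := [isSub for Bplus_val].
HB.instance Definition _ := [Choice of Bplus by <:].
HB.instance Definition _ :=
  SubChoice_isSubSemigroup.Build (partial_map G) Bplus_pred Bplus Bplus_pred_mul.

End BicyclicExtensions.

Record congruence (S : semigroupType) := Congruence {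
  cong_rel :> equiv_rel S;
  congM : forall a b c e : S,
    cong_rel a b -> cong_rel c e -> cong_rel (a * c) (b * e)
}.

Local Open Scope quotient_scope.

Definition quot_semigroup (S : semigroupType) (C : congruence S) : Type :=
  {eq_quot C}.

Section QuotientSemigroup.
Variables (S : semigroupType) (C : congruence S).
Local Notation Q := (quot_semigroup C).

HB.instance Definition _ := Choice.on Q.
HB.instance Definition _ := EqQuotient.on Q.

Definition quot_mul : Q -> Q -> Q := lift_op2 Q (@mul S).

Lemma pi_quot_mul : {morph \pi_Q : x y / x * y >-> quot_mul x y}.
Proof.
move=> x y; unlock quot_mul; apply/eqmodP.
by apply: congM; apply/eqmodP; rewrite reprK.
Qed.

Lemma quot_mulA : associative quot_mul.
Proof.
elim/quotW=> x; elim/quotW=> y; elim/quotW=> z.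
by rewrite -!pi_quot_mul mulgA.
Qed.

HB.instance Definition _ := isSemigroup.Build Q quot_mulA.

End QuotientSemigroup.

Definition is_group (S : semigroupType) : Prop :=
  exists (e : S) (i : S -> S),
    [/\ left_id e *%g, right_id e *%g,
        left_inverse e i *%g & right_inverse e i *%g].

Section CongruenceKinds.
Variables (S : semigroupType) (C : congruence S).

Definition nontrivial_congruence : Prop :=
  ~ (C =2 (fun _ _ => true)) /\ ~ (C =2 (fun a b => a == b)).

Definition group_congruence : Prop := is_group (quot_semigroup C).

End CongruenceKinds.

(* Main.v *)
(** Write [(g, h)] for [alpha g h]; the idempotents are the pairs [(g, g)].  If two
    distinct elements are congruent, then so are two idempotents [(g, g)] and
    [(p, p)] with [g < p]; multiplying by [(k, g)] on the left and [(g, k)] on the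
    right shows that [(k, k)] is congruent to [(a ^ n * k, a ^ n * k)] for all [k]
    and [n], where [a = p * g^-1].  In an archimedean group this identifies all
    idempotents.  Conversely, if all powers of [a > 1] are below [b], comparing
    coordinates modulo the convex subgroup generated by [a] is a congruence that
    identifies the idempotents at [1] and [a] but separates those at [1] and [b]. *)

Require Import Defs.
From mathcomp Require Import all_boot all_order boolp.

Set Implicit Arguments.
Unset Strict Implicit.
Unset Printing Implicit Defensive.

Import Order.TTheory.
Local Open Scope group_scope.
Local Open Scope quotient_scope.

(** * Congruences whose quotient is a group *)

Section Congruences.
Variables (S : semigroupType) (C : congruence S).

Lemma congMl (c a b : S) : C a b -> C (c * a) (c * b).
Proof. by move=> ab; apply: congM. Qed.

Lemma congMr (c a b : S) : C a b -> C (a * c) (b * c).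
Proof. by move=> ab; apply: congM. Qed.

Lemma group_congruence_of (e : S) :
  (forall x, C (e * x) x) -> (forall x, C (x * e) x) ->
  (forall x, exists y, C (y * x) e /\ C (x * y) e) ->
  group_congruence C.
Proof.
move=> el er /choice[i iP].
pose Q := quot_semigroup C.
have piM (x y z : S) : C (x * y) z -> \pi_Q x * \pi_Q y = \pi_Q z :> Q.
  by move=> xyz; rewrite -[LHS]pi_quot_mul; apply/eqmodP.
exists (\pi_Q e), (fun q => \pi_Q (i (repr q))).
split=> q; have [yx xy] := iP (repr q).
- by have := piM _ _ _ (el (repr q)); rewrite reprK.
- by have := piM _ _ _ (er (repr q)); rewrite reprK.
- by have := piM _ _ _ yx; rewrite reprK.
- by have := piM _ _ _ xy; rewrite reprK.
Qed.

(** A group has only one idempotent, so all idempotents of [S] fall into one class. *)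
Lemma group_congruence_idem (x y : S) :
  group_congruence C -> x * x = x -> y * y = y -> C x y.
Proof.
case=> e [i [el er il ir]] xx yy.
pose Q := quot_semigroup C.
have idem (z : S) : z * z = z -> \pi_Q z = e.
  move=> /(congr1 \pi_Q); rewrite pi_quot_mul => zz.
  (* Restated with the semigroup product in place of [quot_mul], so that [mulgA] and the group laws
     apply. *)
  have {zz} : (\pi_Q z : Q) * \pi_Q z = \pi_Q z := zz.
  by move=> /(congr1 (mul (i (\pi_Q z)))); rewrite mulgA il el.
have /eqmodP : \pi_Q x = \pi_Q y by rewrite !idem.
by [].
Qed.

End Congruences.

(** * Inequalities in a linearly ordered group *)

Section Order.
Variables (d : Order.disp_t) (G : loGroupType d).
Implicit Types a x y z w : G.

Lemma leMM x y z w : (x <= y -> z <= w -> x * z <= y * w)%O.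
Proof. by move=> xy zw; apply: le_trans (leM2r z _ _ xy) (leM2l y _ _ zw). Qed.

Lemma leM_ge1 a x : (1 <= a -> x <= a * x)%O.
Proof. by move=> a1; rewrite -{1}[x]mul1g leM2rE. Qed.

Lemma ge1X a n : (1 <= a -> 1 <= a ^+ n)%O.
Proof.
by move=> a1; elim: n => [|n IHn]; rewrite ?expg0// expgS; apply: le1M.
Qed.

Lemma le_divr1 x y : ((1 <= y * x^-1) = (x <= y))%O.
Proof. by rewrite -[LHS](leM2rE x) mul1g mulgVK. Qed.

Lemma lt_divr1 x y : ((1 < y * x^-1) = (x < y))%O.
Proof.
by rewrite !ltNge; congr (~~ _); rewrite -[LHS](leM2rE x) mul1g mulgVK.
Qed.

End Order.

(** * Comparison modulo a convex subgroup *)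

Section CoarseRelation.
Variables (d : Order.disp_t) (G : loGroupType d) (a : G).
Hypothesis a1 : (1 <= a)%O.
Hypothesis Gcomm : forall x y : G, commute x y.
Implicit Types x y z w : G.

(* Equality modulo the convex subgroup generated by [a]. *)
Definition coarse x y := exists n, (x <= a ^+ n * y)%O /\ (y <= a ^+ n * x)%O.

Lemma coarse_refl x : coarse x x.
Proof. by exists 0; rewrite expg0 mul1g. Qed.

Lemma coarse_sym x y : coarse x y -> coarse y x.
Proof. by case=> n [? ?]; exists n. Qed.

Lemma coarse_trans y x z : coarse x y -> coarse y z -> coarse x z.
Proof.
case=> n [xy yx] [m [yz zy]]; exists (n + m); split.
  by rewrite expgnDr -mulgA; apply: le_trans xy (leM2l _ _ _ yz).
by rewrite addnC expgnDr -mulgA; apply: le_trans zy (leM2l _ _ _ yx).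
Qed.

Lemma coarseM x y z w : coarse x y -> coarse z w -> coarse (x * z) (y * w).
Proof.
have mulACA (p q r s : G) : p * q * (r * s) = p * r * (q * s).
  by rewrite -!mulgA [q * (r * s)]mulgA (Gcomm q r) !mulgA.
case=> n [xy yx] [m [zw wz]]; exists (n + m).
by rewrite expgnDr; split; rewrite mulACA; apply: leMM.
Qed.

Lemma coarseV x y : coarse x y -> coarse x^-1 y^-1.
Proof.
(* By commutativity both inequalities say that [1 <= r * q * p^-1]. *)
have leV (p q r : G) : (p <= r * q -> q^-1 <= r * p^-1)%O.
  by rewrite -(le_divr1 p) -(le_divr1 q^-1) invgK -!mulgA (Gcomm q).
by case=> n [xy yx]; exists n; split; apply: leV.
Qed.

(** Powers of [a] are at least [1], so each of the two bounds survives raising its exponent to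
    [n + m]. *)
Lemma coarse_max x y z w :
  coarse x y -> coarse z w -> coarse (Order.max x z) (Order.max y w).
Proof.
have le_max (p q r s : G) n m : (p <= a ^+ n * q -> r <= a ^+ m * s ->
    Order.max p r <= a ^+ (n + m) * Order.max q s)%O.
  move=> pq rs; rewrite ge_max; apply/andP; split.
    rewrite addnC expgnDr -mulgA; apply: le_trans (leM_ge1 _ (ge1X m a1)).
    by apply: le_trans pq (leM2l _ _ _ _); rewrite le_max lexx.
  rewrite expgnDr -mulgA; apply: le_trans (leM_ge1 _ (ge1X n a1)).
  by apply: le_trans rs (leM2l _ _ _ _); rewrite le_max lexx orbT.
by case=> n [xy yx] [m [zw wz]]; exists (n + m); split; apply: le_max.
Qed.

End CoarseRelation.

(* [S] is the semigroup of the maps [alpha g h] with [g] and [h] in the up-set [D].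
   Outside [D] the value of [elt] is irrelevant. *)
Record coordinates d (G : loGroupType d) (D : G -> Prop) (S : semigroupType) :=
  Coordinates {
    src : S -> G;
    tgt : S -> G;
    elt : G -> G -> S;
    src_in : forall s, D (src s);
    tgt_in : forall s, D (tgt s);
    eltK : forall s, elt (src s) (tgt s) = s;
    src_elt : forall g h, D g -> D h -> src (elt g h) = g;
    tgt_elt : forall g h, D g -> D h -> tgt (elt g h) = h;
    eltM : forall g h k l, D g -> D h -> D k -> D l ->
      elt g h * elt k l =
        elt (Order.max h k * h^-1 * g) (Order.max h k * k^-1 * l)
  }.

(** * The equivalence for an arbitrary up-set [D] of coordinates containing [1] *)

Section Characterization.
Variables (d : Order.disp_t) (G : loGroupType d) (D : G -> Prop).
Variables (S : semigroupType) (X : coordinates D S).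
Hypothesis D_up : forall x y : G, (x <= y)%O -> D x -> D y.
Hypothesis D1 : D 1.
Implicit Types (g h k l p q : G) (s t : S).
Local Notation "<| g , h |>" := (elt X g h) (at level 0).

Lemma eltM_le g h k l : D g -> D h -> D k -> D l -> (h <= k)%O ->
  <|g, h|> * <|k, l|> = <|k * h^-1 * g, l|>.
Proof. by move=> Dg Dh Dk Dl hk; rewrite eltM// max_r// mulgV mul1g. Qed.

Lemma eltM_ge g h k l : D g -> D h -> D k -> D l -> (k <= h)%O ->
  <|g, h|> * <|k, l|> = <|g, h * k^-1 * l|>.
Proof. by move=> Dg Dh Dk Dl kh; rewrite eltM// max_l// mulgV mul1g. Qed.

Lemma eltM_eq g h l : D g -> D h -> D l -> <|g, h|> * <|h, l|> = <|g, l|>.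
Proof. by move=> Dg Dh Dl; rewrite eltM_le// mulgV mul1g. Qed.

Lemma elt_idem g : D g -> <|g, g|> * <|g, g|> = <|g, g|>.
Proof. by move=> Dg; rewrite eltM_eq. Qed.

Lemma idemM k p : D k -> D p -> (k <= p)%O -> <|k, k|> * <|p, p|> = <|p, p|>.
Proof. by move=> Dk Dp kp; rewrite eltM_le// mulgVK. Qed.

Lemma idemMr k p : D k -> D p -> (k <= p)%O -> <|p, p|> * <|k, k|> = <|p, p|>.
Proof. by move=> Dk Dp kp; rewrite eltM_ge// mulgVK. Qed.

Section Congruence.
Variable C : congruence S.

(** Multiplying by [(h, g)] on the right gives [(g, g)] congruent to some [(p, q)] with [g < p] and
    [g <= q]. Since [(p, p)] absorbs [(g, g)] and fixes [(p, q)], multiplying by it on the left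
    makes [(p, p)] congruent to [(p, q)], hence to [(g, g)]. *)
Lemma cong_src_lt g h k l : D g -> D h -> D k -> D l -> (g < k)%O ->
  C <|g, h|> <|k, l|> ->
  exists p, [/\ D p, (g < p)%O & C <|g, g|> <|p, p|>].
Proof.
move=> Dg Dh Dk Dl gk /(congMr <|h, g|>).
rewrite eltM_eq// eltM//.
set p := _ * _ * k; set q := _ * _ * g => gpq.
have kp : (k <= p)%O by apply: leM_ge1; rewrite le_divr1 le_max lexx.
have gq : (g <= q)%O by apply: leM_ge1; rewrite le_divr1 le_max lexx orbT.
have Dp := D_up kp Dk; have Dq := D_up gq Dg.
have gp := lt_le_trans gk kp.
exists p; split=> //; apply: (equiv_trans gpq).
have /(congMl <|p, p|>) := gpq.
by rewrite idemMr ?(ltW gp)// eltM_eq// equiv_sym.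
Qed.

(** Both idempotents are congruent to [(h, l)]: multiply by [(h, g)] on the left, then by [(l, l)]
    on the right. *)
Lemma cong_tgt_lt g h l : D g -> D h -> D l -> (h < l)%O ->
  C <|g, h|> <|g, l|> -> C <|h, h|> <|l, l|>.
Proof.
move=> Dg Dh Dl hl /(congMl <|h, g|>); rewrite !eltM_eq// => hhl.
have /(congMr <|l, l|>) := hhl; rewrite idemM ?(ltW hl)// eltM_eq// => ll.
by rewrite (equiv_trans hhl)// equiv_sym.
Qed.

Lemma cong_idem_lt s t : C s t -> s != t ->
  exists g p, [/\ D g, D p, (g < p)%O & C <|g, g|> <|p, p|>].
Proof.
rewrite -(eltK X s) -(eltK X t).
have [] := (src_in X s, tgt_in X s); have [] := (src_in X t, tgt_in X t).
move: (src _ s) (tgt _ s) (src _ t) (tgt _ t) => g h k l Dk Dl Dg Dh st st'.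
have [gk|kg|gk] := ltgtP g k.
- by have [p [? ? ?]] := cong_src_lt Dg Dh Dk Dl gk st; exists g, p.
- rewrite equiv_sym in st.
  by have [p [? ? ?]] := cong_src_lt Dk Dl Dg Dh kg st; exists k, p.
subst k; have [hl|lh|hl] := ltgtP h l.
- by exists h, l; split=> //; apply: cong_tgt_lt st.
- by exists l, h; split=> //; apply: (@cong_tgt_lt g) => //; rewrite equiv_sym.
by rewrite hl eqxx in st'.
Qed.

Lemma cong_idem_shift g p k : D g -> D p -> D k -> (g < p)%O ->
  C <|g, g|> <|p, p|> ->
  C <|k, k|> <|p * g^-1 * k, p * g^-1 * k|>.
Proof.
move=> Dg Dp Dk /ltW gp /(congMl <|k, g|>) /(congMr <|g, k|>).
have Da : D (p * g^-1 * k) by apply: D_up Dk; apply: leM_ge1; rewrite le_divr1.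
by rewrite !eltM_eq// eltM_le// eltM_ge.
Qed.

Lemma cong_idem_expg a k n : (1 <= a)%O -> D k ->
  (forall l, D l -> C <|l, l|> <|a * l, a * l|>) ->
  C <|k, k|> <|a ^+ n * k, a ^+ n * k|>.
Proof.
move=> a1 Dk aC; elim: n => [|n IHn]; first by rewrite expg0 mul1g.
rewrite expgS -mulgA; apply: (equiv_trans IHn); apply: aC.
by apply: D_up Dk; apply/leM_ge1/ge1X.
Qed.

(** Multiplying by [(l, l)] turns [(k, k)] into [(l, l)] and leaves [(q, q)] unchanged. *)
Lemma cong_idem_convex k l q : D k -> (k <= l <= q)%O ->
  C <|k, k|> <|q, q|> -> C <|k, k|> <|l, l|>.
Proof.
move=> Dk /andP[kl lq] kq.
have Dl := D_up kl Dk; have Dq := D_up lq Dl.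
have /(congMr <|l, l|>) := kq; rewrite idemM// idemMr// => lq'.
by apply: (equiv_trans kq); rewrite equiv_sym.
Qed.

Lemma archimedean_cong_idem s t : archimedean_group G -> C s t -> s != t ->
  forall k l, D k -> D l -> C <|k, k|> <|l, l|>.
Proof.
move=> archG st /(cong_idem_lt st)[g [p [Dg Dp gp gpC]]].
have a1 : (1 < p * g^-1)%O by rewrite lt_divr1.
have ltC k l : D k -> (k < l)%O -> C <|k, k|> <|l, l|>.
  move=> Dk kl; have : (1 < l * k^-1)%O by rewrite lt_divr1.
  move=> /(archG _ _ a1)[n [_ [_ _ ln _]]].
  apply: (@cong_idem_convex k l ((p * g^-1) ^+ n * k)) => //.
    by rewrite (ltW kl) -(leM2rE k^-1) mulgK.
  apply: cong_idem_expg => //; first exact: ltW.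
  by move=> x Dx; apply: cong_idem_shift.
move=> k l Dk Dl; have [kl|lk|->] := ltgtP k l; [exact: ltC| |by []].
by rewrite equiv_sym; apply: ltC.
Qed.

(** The inverse of [(g, h)] is [(h, g)]: their products in either order are idempotents, hence
    congruent to the identity [(1, 1)]. *)
Lemma idem_group_congruence :
  (forall k l, D k -> D l -> C <|k, k|> <|l, l|>) -> group_congruence C.
Proof.
move=> idemC; apply: (@group_congruence_of _ C <|1, 1|>) => x;
  rewrite -(eltK X x); have [] := (src_in X x, tgt_in X x);
  move: (src _ x) (tgt _ x) => g h Dg Dh.
- by rewrite -{2}(@eltM_eq g g h)//; apply/congMr/idemC.
- by rewrite -{2}(@eltM_eq g h h)//; apply/congMl/idemC.
- by exists <|h, g|>; rewrite !eltM_eq//; split; apply: idemC.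
Qed.

End Congruence.

Lemma archimedean_group_congruence : archimedean_group G ->
  forall C : congruence S, nontrivial_congruence C -> group_congruence C.
Proof.
move=> archG C [_ neqC]; apply: idem_group_congruence.
suff [s [t [st st']]] : exists s t, C s t /\ s != t.
  exact: archimedean_cong_idem st st'.
apply: contrapT => noC; apply: neqC => s t.
apply/idP/eqP => [st|->]; last exact: equiv_refl.
by apply: contrapT => /eqP st'; apply: noC; exists s, t.
Qed.

Section CoarseCongruence.
Variable a : G.
Hypothesis a1 : (1 <= a)%O.
Hypothesis Gcomm : forall x y : G, commute x y.

Definition coarse_rel s t : bool :=
  `[< coarse a (src X s) (src X t) /\ coarse a (tgt X s) (tgt X t) >].

Lemma coarse_rel_equiv : equiv_class_of coarse_rel.
Proof.
split=> [s|s t|t s u].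
- by apply/asboolP; split; apply: coarse_refl.
- by apply/asboolP/asboolP => -[? ?]; split; apply: coarse_sym.
- move=> /asboolP[st st'] /asboolP[tu tu'].
  by apply/asboolP; split; [apply: coarse_trans tu|apply: coarse_trans tu'].
Qed.

Lemma coordM s t : let m := Order.max (tgt X s) (src X t) in
  src X (s * t) = m * (tgt X s)^-1 * src X s /\
  tgt X (s * t) = m * (src X t)^-1 * tgt X t.
Proof.
move=> m.
have [Ds Ds'] := (src_in X s, tgt_in X s).
have [Dt Dt'] := (src_in X t, tgt_in X t).
(* The product's coordinates must lie in [D] before [src_elt] and [tgt_elt] can read them off. *)
have D3 : D (m * (tgt X s)^-1 * src X s).
  by apply: D_up Ds; apply: leM_ge1; rewrite le_divr1 le_max lexx.
have D4 : D (m * (src X t)^-1 * tgt X t).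
  by apply: D_up Dt'; apply: leM_ge1; rewrite le_divr1 le_max lexx orbT.
by rewrite -(eltK X s) -(eltK X t) eltM// !eltK src_elt// tgt_elt.
Qed.

(** The coordinates of a product are built from maxima, inverses and products, all of which respect
    [coarse]. *)
Lemma coarse_relM s t u v :
  coarse_rel s t -> coarse_rel u v -> coarse_rel (s * u) (t * v).
Proof.
move=> /asboolP[st st'] /asboolP[uv uv']; apply/asboolP.
have [-> ->] := coordM s u; have [-> ->] := coordM t v.
have mm := coarse_max a1 st' uv.
by split; do 2![apply: coarseM => //]; apply: coarseV.
Qed.

Definition coarse_congruence : congruence S :=
  @Congruence S (EquivRelPack coarse_rel_equiv) coarse_relM.

End CoarseCongruence.

Lemma archimedean_of_group_congruence
    (Gcomm : forall x y : G, commute x y) :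
  (forall C : congruence S, nontrivial_congruence C -> group_congruence C) ->
  archimedean_group G.
Proof.
move=> groupC.
(* The two bounds are the same claim with [a] and [b] exchanged. *)
suff dom (a b : G) : (1 < a)%O -> (1 < b)%O -> exists2 m, 0 < m & (b <= a ^+ m)%O.
  move=> a b a1 b1; have [m m0 mP] := dom a b a1 b1.
  by have [n n0 nP] := dom b a b1 a1; exists m, n.
move=> a1 b1; apply: contrapT => nodom.
pose C := coarse_congruence (ltW a1) Gcomm.
have Da : D a by apply: D_up D1; apply: ltW.
have Db : D b by apply: D_up D1; apply: ltW.
have sepC : ~ C <|1, 1|> <|b, b|>.
  move=> /asboolP[]; rewrite !src_elt// => -[n [_]]; rewrite mulg1 => bn _.
  (* [nodom] excludes only positive exponents; exponent [0] would give [b <= 1]. *)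
  case: n bn => [|n] bn; last by apply: nodom; exists n.+1.
  by rewrite expg0 leNgt b1 in bn.
(* A group congruence would identify the idempotents at [1] and [b]. It remains to see that [C] is
   non-trivial: [sepC] rules out the universal congruence, the pair [1], [a] the identity. *)
apply: (sepC); apply: group_congruence_idem; rewrite ?elt_idem//.
apply: groupC; split=> [univC|idC].
  by apply: sepC; rewrite univC.
have : C <|1, 1|> <|a, a|>.
  by apply/asboolP; rewrite !src_elt// !tgt_elt//; split; exists 1%N;
    rewrite expg1 mulg1; split; rewrite // ltW// (lt_le_trans a1)// leM_ge1 ?ltW.
rewrite idC => /eqP /(congr1 (src X)); rewrite !src_elt// => aE.
by move: (a1); rewrite -aE ltxx.
Qed.

End Characterization.

(** * Coordinates on the two concrete semigroups *)

Section Instances.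
Variables (d : Order.disp_t) (G : loGroupType d).

(** [g] is the least point of the domain of [alpha g h], and [h] is its image. *)
Lemma alpha_inj (g h k l : G) :
  alpha g h = alpha k l -> g = k /\ h = l.
Proof.
move=> E; have gk : g = k.
  apply/eqP; rewrite eq_le; apply/andP; split.
    by have := congr1 (fun f => f k) E; rewrite /alpha lexx; case: ifP.
  by have := congr1 (fun f => f g) E; rewrite /alpha lexx; case: ifP.
split=> //; have := congr1 (fun f => f g) E.
by rewrite /alpha gk lexx !mulgV !mul1g => -[].
Qed.

Lemma coordinates_of (D : G -> Prop) (S : semigroupType)
    (val : S -> partial_map G) (elt : G -> G -> S) :
  injective val -> {morph val : s t / s * t} ->
  (forall x y : G, (x <= y)%O -> D x -> D y) ->
  (forall s, exists g h, [/\ D g, D h & val s = alpha g h]) ->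
  (forall g h, D g -> D h -> val (elt g h) = alpha g h) ->
  inhabited (coordinates D S).
Proof.
move=> val_inj valM D_up valP eltE.
have /choice[c cP] s : exists gh : G * G,
    [/\ D gh.1, D gh.2 & val s = alpha gh.1 gh.2].
  by have [g [h ?]] := valP s; exists (g, h).
have coordE g h : D g -> D h -> c (elt g h) = (g, h).
  move=> Dg Dh; have [_ _] := cP (elt g h); rewrite eltE// => /alpha_inj[gE hE].
  by rewrite [LHS]surjective_pairing -gE -hE.
split; apply: (@Coordinates _ _ _ _ (fun s => (c s).1) (fun s => (c s).2) elt).
- by move=> s; case: (cP s).
- by move=> s; case: (cP s).
- by move=> s; case: (cP s) => D1 D2 E; apply: val_inj; rewrite eltE.
- by move=> g h Dg Dh; rewrite coordE.
- by move=> g h Dg Dh; rewrite coordE.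
move=> g h k l Dg Dh Dk Dl; apply: val_inj; rewrite valM !eltE ?alphaM//.
  by apply: D_up Dg; apply: leM_ge1; rewrite le_divr1 le_max lexx.
by apply: D_up Dl; apply: leM_ge1; rewrite le_divr1 le_max lexx orbT.
Qed.

Lemma alpha_in_B (g h : G) : alpha g h \in @Bpred d G.
Proof. by apply/asboolP; exists g, h. Qed.

Lemma B_coordinates : inhabited (coordinates (fun _ : G => True) (B G)).
Proof.
apply: (@coordinates_of _ (B G) (@B_val d G) (fun g h => MkB (alpha_in_B g h))).
- exact: val_inj.
- by [].
- by [].
- by move=> [f /= /asboolP[g [h ->]]]; exists g, h.
- by [].
Qed.

(** Clamping by [Order.max 1] makes [elt] total on [G] without changing it on the positive cone. *)
Lemma alpha_max_in_Bplus (g h : G) :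
  alpha (Order.max 1 g) (Order.max 1 h) \in @Bplus_pred d G.
Proof. by apply/asboolP; do 2!eexists; split; last by []; rewrite le_max lexx. Qed.

Lemma Bplus_coordinates :
  inhabited (coordinates (fun g : G => (1 <= g)%O) (Bplus G)).
Proof.
apply: (@coordinates_of _ (Bplus G) (@Bplus_val d G)
          (fun g h => MkBplus (alpha_max_in_Bplus g h))).
- exact: val_inj.
- by [].
- by move=> x y xy x1; apply: le_trans xy.
- by move=> [f /= /asboolP[g [h [g1 h1 ->]]]]; exists g, h.
- by move=> g h g1 h1 /=; rewrite !max_r.
Qed.

End Instances.

Theorem theorem3p6 (d : Order.disp_t) (G : loGroupType d)
    (Gcomm : forall x y : G, commute x y) :
  [<-> archimedean_group G;
       forall C : congruence (B G),
         nontrivial_congruence C -> group_congruence C;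
       forall C : congruence (Bplus G),
         nontrivial_congruence C -> group_congruence C].
Proof.
have [XB] := B_coordinates G; have [XBp] := Bplus_coordinates G.
have Dp_up (x y : G) : (x <= y -> 1 <= x -> 1 <= y)%O.
  by move=> xy x1; apply: le_trans xy.
tfae.
- exact: (archimedean_group_congruence XB).
(* The passage between the two semigroups goes through the archimedean property. *)
- move=> groupB; apply: (archimedean_group_congruence XBp) => //.
  exact: (archimedean_of_group_congruence XB).
- exact: (archimedean_of_group_congruence XBp).
Qed.
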